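(* For every $\theta\in l_{2}$ and every probability measure $Q\in \mathcal{A}$, there exists $\widetilde{Q}\in \mathcal{A}_{\mathrm{D}}$ such that \[ l(\theta,\widetilde{Q})\leq l(\theta,Q). \] In particular, for any subset $\Theta$ of $l_{2}$, \[ \inf_{\widehat{Q}\in\mathcal{D}}\sup_{\theta\in\Theta}R(\theta,\widehat{Q}) =\inf_{\widehat{Q}\in\mathcal{D}_{\mathrm{D}}}\sup_{\theta\in\Theta}R(\theta,\widehat{Q}). \]
   Context: Fix constants $\varepsilon>0$, $\tilde{\varepsilon}>0$. Let $l_{2}=\{\theta\in\mathbb{R}^\infty:\sum_{i}\theta_{i}^{2}<\infty\}$ and let $\mathcal{R}^{\infty}$ be the product $\sigma$-field on $\mathbb{R}^{\infty}$ of Borel $\sigma$-fields. For $\theta\in l_2$, $P_{\theta}=\bigotimes_{i}\mathcal{N}(\theta_{i},\varepsilon^{2})$ is the law of the observation $X$ ($X_i=\theta_i+\varepsilon W_i$) and $Q_{\theta}=\bigotimes_{i}\mathcal{N}(\theta_{i},\tilde{\varepsilon}^{2})$ is the law of the future observation $Y$ ($Y_i=\theta_i+\tilde\varepsilon\widetilde W_i$), with $W,\widetilde W$ independent i.i.d. standard normal sequences. $\mathcal{A}$ is the set of all probability measures on $(\mathbb{R}^{\infty},\mathcal{R}^{\infty})$. The Kullback--Leibler loss is $l(\theta,Q)=\int \log\frac{\mathrm{d}Q_{\theta}}{\mathrm{d}Q}\,\mathrm{d}Q_{\theta}$ if $Q_\theta\ll Q$, and $\infty$ otherwise. $\mathcal{D}$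 is the set of predictive distributions $\widehat Q:\mathbb{R}^\infty\to\mathcal{A}$, $x\mapsto\widehat Q(\cdot;x)$, and the risk is $R(\theta,\widehat{Q})=\int l(\theta,\widehat{Q}(\cdot;x))\,\mathrm{d}P_{\theta}(x)$. Let $\lambda_{i}=1/\{\pi(i-1/2)\}^{2}$, $e_{i}(t)=\sqrt{2}\sin((i-1/2)\pi t)$, and $S_{\mathrm{D}}=\{x\in \mathbb{R}^{\infty}: \sum_{i=1}^{\infty}x_{i}\sqrt{\lambda_{i}}e_{i}(\cdot)\text{ converges in } L_{2}[0,1]\}$, a measurable subset of $\mathbb{R}^\infty$. $\mathcal{A}_{\mathrm{D}}$ is the set of probability measures on $S_{\mathrm D}$ with the relative $\sigma$-field of $\mathcal{R}^\infty$ (for which $l(\theta,\cdot)$ is defined in the same way, since $Q_\theta(S_{\mathrm D})=1$), and $\mathcal{D}_{\mathrm{D}}=\{\widehat{Q}:\mathbb{R}^{\infty}\to\mathcal{A}_{\mathrm{D}}\}$. *)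

(* Defs.v *)
From HB Require Import structures.
From mathcomp Require Import all_boot all_order all_algebra.
From mathcomp Require Import all_classical all_reals all_analysis.
Set Implicit Arguments. Unset Strict Implicit. Unset Printing Implicit Defensive.
Import Order.TTheory GRing.Theory Num.Theory.
Import numFieldNormedType.Exports.
Local Open Scope classical_set_scope.
Local Open Scope ring_scope.

(* Coordinates of R^infty are indexed by nat starting at 0: the paper's
   coordinate i (i >= 1) is our coordinate i-1. *)

Definition coord_cylinders (R : realType) : set (set (nat -> R)) :=
  [set [set x | B (x i)] | i in [set: nat] & B in [set B : set R | measurable B]].

Notation Rinf R := (g_sigma_algebraType (@coord_cylinders R)).

Section defs.
Variable R : realType.

Definition l2 : set (nat -> R) :=
  [set theta : nat -> R | cvgn (series (fun i => theta i ^+ 2))].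

(** [gauss_prod m s P] : P is the product measure (x)_i N(m_i, s^2), i.e.
    its finite-dimensional marginals are products of normal laws with mean
    m_i and standard deviation s.  (This characterizes P uniquely.) *)
Definition gauss_prod (m : nat -> R) (s : R) (P : probability (Rinf R) R) : Prop :=
  forall (n : nat) (B : nat -> set R), (forall i, measurable (B i)) ->
    P [set x : (Rinf R) | forall i, (i < n)%N -> B i (x i)] =
    \big[*%E/1%E]_(i < n) normal_prob (m i) s (B i).

Definition KL (Qth Q : probability (Rinf R) R) : \bar R :=
  if pselect ((Qth : set (Rinf R) -> \bar R) `<< (Q : set (Rinf R) -> \bar R)) then
    (\int[Qth]_x
       (ln (fine (charge.Radon_Nikodym (charge_of_finite_measure Qth) Q x)))%:E)%E
  else +oo%E.

(** lambda_i and e_i (paper index i = our index i+1) *)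
Definition lam (i : nat) : R := (pi * (i%:R + 2^-1)) ^- 2.
Definition efun (i : nat) (t : R) : R :=
  Num.sqrt 2 * sin ((i%:R + 2^-1) * pi * t).

Definition partial_sum (x : nat -> R) (n : nat) (t : R) : R :=
  \sum_(i < n) x i * Num.sqrt (lam i) * efun i t.

Definition SD : set (nat -> R) :=
  [set x : nat -> R | exists g : R -> R,
     [/\ measurable_fun (`[0%R, 1%R] : set R) g,
         (\int[lebesgue_measure]_(t in (`[0%R, 1%R] : set R)) ((g t ^+ 2)%R)%:E < +oo)%E &
         (fun n => \int[lebesgue_measure]_(t in (`[0%R, 1%R] : set R))
                      (((partial_sum x n t - g t) ^+ 2)%R)%:E)%E @ \oo --> 0%E]].

Definition in_AD (Q : probability (Rinf R) R) : Prop := Q (SD : set (Rinf R)) = 1%E.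

Definition risk (Pth Qth : probability (Rinf R) R)
    (Qhat : (Rinf R) -> probability (Rinf R) R) : \bar R :=
  (\int[Pth]_x KL Qth (Qhat x))%E.

End defs.

(* Main.v *)
(** Conditioning a predictive law [Q] on an event [A] of full [Q_theta]-measure
    multiplies the density of [Q_theta] by [Q(A) <= 1], so it can only decrease
    the Kullback-Leibler loss, and the conditioned law does not depend on
    [theta]; if [Q(A) = 0] the loss of [Q] is infinite. It remains to find such an
    [A] inside [SD].

    [A] asks that [sum_k 2^k * sum_(4^k <= i < 4^(k+1)) lam_i x_i^2] be finite.
    This has finite expectation because the second moments of the coordinates are
    bounded. On [A] the partial sums at the times [4^k] converge almost everywhere
    in [t], and, by orthonormality of the [e_i] and Fatou's lemma, the whole
    sequence converges in [L_2] to this almost everywhere limit. *)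

Require Import Defs.
From HB Require Import structures.
From mathcomp Require Import all_boot all_order all_algebra.
From mathcomp Require Import all_classical all_reals all_analysis.
From mathcomp Require Import measurable_realfun ring lra.
Import Order.TTheory GRing.Theory Num.Theory.
Import numFieldNormedType.Exports.
Local Open Scope classical_set_scope.
Local Open Scope ring_scope.
Local Open Scope charge_scope.

Set Implicit Arguments.
Unset Strict Implicit.

(** * Monotonicity of the integral of extended-real functions *)

Section integral_monotonicity.
Context d (T : measurableType d) (R : realType) (mu : {measure set T -> \bar R}).
Local Open Scope ereal_scope.

(* No measurability is assumed: the loss [x |-> KL Qth (Qhat x)] of an arbitrary
   predictive distribution need not be measurable. *)
Lemma le_integral_pointwise (f g : T -> \bar R) :
  (forall x, f x <= g x) -> \int[mu]_x f x <= \int[mu]_x g x.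
Proof.
move=> fg; rewrite /integral !patch_setT.
apply: leeB; apply: ereal_sup_le => _ /= [h hle <-]; exists h => // x.
- apply: (le_trans (hle x)); rewrite !funeposE.
  by rewrite ge_max le_max fg/= le_max lexx orbT.
- apply: (le_trans (hle x)); rewrite !funenegE.
  by rewrite ge_max le_max leeN2 fg/= le_max lexx orbT.
Qed.

(** Positive parts are ordered like [f] and [g], negative parts the other way round. Comparing them
    separately allows either integral to be infinite, as a Kullback-Leibler loss can be. *)
Lemma ae_le_integral_measurable (f g : T -> \bar R) :
  measurable_fun setT f -> measurable_fun setT g ->
  {ae mu, forall x, f x <= g x} -> \int[mu]_x f x <= \int[mu]_x g x.
Proof.
move=> mf mg fg; rewrite integralE [leRHS]integralE.
apply: leeB; apply: ae_ge0_le_integral => //.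
- exact: measurable_funepos.
- exact: measurable_funepos.
- apply: filterS fg => x fgx _; rewrite !funeposE.
  by rewrite ge_max le_max fgx/= le_max lexx orbT.
- exact: measurable_funeneg.
- exact: measurable_funeneg.
- apply: filterS fg => x fgx _; rewrite !funenegE.
  by rewrite ge_max le_max leeN2 fgx/= le_max lexx orbT.
Qed.

End integral_monotonicity.

Lemma probability1_ae d (T : measurableType d) (R : realType)
    (P : probability T R) (A : set T) :
  measurable A -> P A = 1%E -> {ae P, forall x, A x}.
Proof.
move=> mA PA; exists (~` A); split => //; first exact: measurableC.
by rewrite probability_setC// PA subee.
Qed.

(** * Conditioning a probability on an event, and its densities *)

Section conditioning.
Context d (T : measurableType d) (R : realType).
Variables (P Q P0 : probability T R) (A : set T) (mA : measurable A).
Local Open Scope ereal_scope.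

(* [P0] is the value when [Q A = 0]. *)
Definition condition : probability T R := mnormalize (mrestr Q mA) P0.

Lemma conditionE (Q0 : Q A != 0) (B : set T) :
  condition B = Q (B `&` A) * (fine (Q A))^-1%:E.
Proof.
rewrite /condition /= /mnormalize /= /mrestr setTI (negbTE Q0)/=.
by rewrite lt_eqF// ltey_eq fin_num_measure.
Qed.

(** The identity [B ∩ A = A] is set-theoretic, so [B] may be any superset of [A]. The hypothesis on
    [P0] covers the case [Q A = 0]. *)
Lemma condition_supset (B : set T) : A `<=` B -> P0 B = 1 -> condition B = 1.
Proof.
move=> AB P0B; have [Q0|Q0] := eqVneq (Q A) 0.
  by rewrite /condition /= /mnormalize /= /mrestr setTI Q0 eqxx/= P0B.
rewrite conditionE// setIC (setIidl AB) -{1}(fineK (fin_num_measure Q A mA)).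
by rewrite -EFinM divff// fine_eq0// fin_num_measure.
Qed.

Lemma condition_dominated (Q0 : Q A != 0) : condition `<< Q.
Proof.
apply/null_content_dominatesP => B mB QB.
rewrite conditionE// (@subset_measure0 _ _ _ _ _ B)//; last exact: measurableI.
by rewrite mul0e.
Qed.

(** [P] charges [A], hence so does [Q]. If [B] is null for the conditioned law, then [B ∩ A] is
    [Q]-null, hence [P]-null, while the rest of [B] lies in the [P]-null complement of [A]. *)
Lemma dominates_condition (PA : P A = 1) : P `<< Q ->
  Q A != 0 /\ P `<< condition.
Proof.
move=> /null_content_dominatesP PQ.
have Q0 : Q A != 0.
  by apply/eqP => QA; move: (PQ _ mA QA); rewrite PA => /eqP; rewrite onee_eq0.
split=> //; apply/null_content_dominatesP => B mB.
move=> CB; have : condition B = 0 by exact: CB.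
rewrite conditionE// => /eqP.
rewrite mule_eq0 eqe invr_eq0 fine_eq0 ?fin_num_measure//.
rewrite (negbTE Q0) orbF => /eqP QBA.
have PBA : P (B `&` A) = 0 by apply: PQ => //; exact: measurableI.
apply/eqP; rewrite eq_le measure_ge0 andbT.
have -> : B = (B `&` A) `|` (B `\` A) by rewrite setDE -setIUr setUv setIT.
apply: (@le_trans _ _ (P (B `&` A) + P (B `\` A))).
  by apply: measureU2; [exact: measurableI|exact: measurableD].
rewrite PBA add0e -[leRHS](_ : P (~` A) = 0); last by rewrite probability_setC// PA subee.
by apply: le_measure; rewrite ?inE; [exact: measurableD|exact: measurableC|move=> x []].
Qed.

Lemma Radon_Nikodym_condition (Q0 : Q A != 0) :
  ae_eq Q setT ('d (charge_of_finite_measure condition) '/d Q)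
    (fun x => (\1_A x * (fine (Q A))^-1)%:E).
Proof.
have mf : measurable_fun setT (fun x => (\1_A x * (fine (Q A))^-1)%:E : \bar R).
  by apply/measurable_EFinP/measurable_funM.
apply: integral_ae_eq => //.
  exact/Radon_Nikodym_integrable/condition_dominated.
move=> E _ mE; rewrite -Radon_Nikodym_integral//; last exact: condition_dominated.
under eq_integral do rewrite EFinM.
rewrite ge0_integralZr//; last 2 first.
- exact/measurable_EFinP.
- by rewrite lee_fin invr_ge0 fine_ge0.
rewrite integral_indic//= setIC; exact: conditionE.
Qed.

(** Chain rule through the conditioned law, whose density with respect to [Q] is the indicator of
    [A] over [Q A]. The [Q]-almost everywhere identities pass to [P] by domination, and the
    indicator is 1 for [P]-almost every point. *)
Lemma Radon_Nikodym_dominates_condition (PA : P A = 1) (PQ : P `<< Q) :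
  {ae P, forall x, 'd (charge_of_finite_measure P) '/d Q x =
    'd (charge_of_finite_measure P) '/d condition x * (fine (Q A))^-1%:E}.
Proof.
have [Q0 PC] := dominates_condition PA PQ.
have H1 := @Radon_Nikodym_chain_rule _ _ _ (charge_of_finite_measure P) Q
  condition PC (condition_dominated Q0).
have H2 := Radon_Nikodym_condition Q0.
move: H1 => /(null_dominates_ae_eq measurableT PQ) H1.
move: H2 => /(null_dominates_ae_eq measurableT PQ) H2.
move: H1 H2 (probability1_ae mA PA); apply: filterS3 => x /(_ I) -> /(_ I) /= -> Ax.
by rewrite indicE mem_set// mul1r.
Qed.

End conditioning.

(** * Kullback-Leibler loss under conditioning *)

Lemma KL_dominated (R : realType) (P Q : probability (Rinf R) R) :
  (P : set (Rinf R) -> \bar R) `<< (Q : set (Rinf R) -> \bar R) ->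
  KL P Q = (\int[P]_x
    (ln (fine ('d (charge_of_finite_measure P) '/d Q x)))%:E)%E.
Proof. by rewrite /KL => PQ; destruct (pselect _) as [|[]]. Qed.

Lemma KL_not_dominated (R : realType) (P Q : probability (Rinf R) R) :
  ~ (P : set (Rinf R) -> \bar R) `<< (Q : set (Rinf R) -> \bar R) ->
  KL P Q = +oo%E.
Proof. by rewrite /KL => PQ; destruct (pselect _). Qed.

Lemma KL_condition_le (R : realType) (P Q P0 : probability (Rinf R) R)
    (A : set (Rinf R)) (mA : measurable A) :
  P A = 1%E -> (KL P (condition Q P0 mA) <= KL P Q)%E.
Proof.
move=> PA; have [PQ|PQ] := pselect ((P : set (Rinf R) -> \bar R) `<< Q); last first.
  by rewrite (KL_not_dominated PQ) leey.
have [Q0 PC] := dominates_condition P0 mA PA PQ.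
rewrite (KL_dominated PQ) (KL_dominated PC).
have mKL (Q1 : probability (Rinf R) R) : (P : set _ -> \bar R) `<< Q1 ->
    measurable_fun setT
      (fun x => (ln (fine ('d (charge_of_finite_measure P) '/d Q1 x)))%:E).
  move=> PQ1; apply/measurable_EFinP; do 2 apply: measurableT_comp => //.
apply: ae_le_integral_measurable; [exact: mKL|exact: mKL|].
apply: filterS (Radon_Nikodym_dominates_condition P0 mA PA PQ) => x ->.
have q0 : 0 < fine (Q A).
  by rewrite fine_gt0// lt_neqAle eq_sym Q0 measure_ge0/= ltey_eq fin_num_measure.
have q1 : fine (Q A) <= 1.
  by rewrite -lee_fin fineK ?fin_num_measure// probability_le1.
rewrite fineM//; last exact: Radon_Nikodym_fin_num.
set f := fine _; rewrite lee_fin /=.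
(* [ln] takes the value 0 on nonpositive reals, so both sides vanish when [f <= 0]. *)
have [f0|f0] := leP f 0.
  by rewrite !ln0// pmulr_lle0// invr_gt0.
rewrite ler_ln ?posrE ?mulr_gt0 ?invr_gt0//.
by apply: ler_peMr; [exact: ltW|rewrite invf_ge1].
Qed.

(** * Equality of the two minimax risks *)

Section minimax.
Context (R : realType) (A : set (Rinf R)) (mA : measurable A).
Variable P0 : probability (Rinf R) R.
Hypotheses (AS : A `<=` (@SD R)) (P0A : in_AD P0).
Variables (P Q : (nat -> R) -> probability (Rinf R) R) (Theta : set (nat -> R)).
Hypothesis QA : forall theta, Theta theta -> Q theta A = 1%E.

Lemma in_AD_condition (Q' : probability (Rinf R) R) :
  in_AD (condition Q' P0 mA).
Proof. exact: condition_supset. Qed.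

(** One inequality is inclusion of the classes. For the other, each [Qhat x] is conditioned on the
    same [A], chosen independently of [theta] and [x]; this lowers the loss at every [x], hence the
    risk at every [theta] in [Theta]. *)
Lemma minimax_eq_conditioned :
  ereal_inf [set ereal_sup [set risk (P theta) (Q theta) Qhat | theta in Theta]
            | Qhat in [set: Rinf R -> probability (Rinf R) R]] =
  ereal_inf [set ereal_sup [set risk (P theta) (Q theta) Qhat | theta in Theta]
            | Qhat in [set Qhat : Rinf R -> probability (Rinf R) R |
                        forall x, in_AD (Qhat x)]].
Proof.
apply/eqP; rewrite eq_le; apply/andP; split.
  by apply: ereal_inf_le_tmp => _ /= [Qhat _ <-]; exists Qhat.
apply: le_ereal_inf_tmp => _ /= [Qhat _ <-].
apply: (@le_trans _ _ (ereal_sup [set risk (P theta) (Q theta)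
    (fun x => condition (Qhat x) P0 mA) | theta in Theta])).
  apply: ereal_inf_lbound; exists (fun x => condition (Qhat x) P0 mA) => //= x.
  exact: in_AD_condition.
apply: ge_ereal_sup => _ /= [theta Ttheta <-].
apply: (@le_trans _ _ (risk (P theta) (Q theta) Qhat)).
  by apply: le_integral_pointwise => x; exact: KL_condition_le (QA Ttheta).
by apply: ereal_sup_ubound; exists theta.
Qed.

End minimax.

(** * Second moments of normal laws *)

Section normal_moments.
Context (R : realType).
Notation mu := (@lebesgue_measure R).

(** The Radon-Nikodym derivative of [normal_prob] and [normal_pdf] have the same integral over every
    measurable set, so they agree almost everywhere. *)
Lemma integral_normal_prob (m s : R) (f : R -> \bar R) :
  measurable_fun setT f -> (forall x, 0 <= f x)%E ->
  (\int[normal_prob m s]_x f x = \int[mu]_x (f x * (normal_pdf m s x)%:E))%E.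
Proof.
move=> mf f0.
rewrite -(Radon_Nikodym_SigmaFinite.change_of_variables (normal_prob_dominates m s))//.
have mg := measurable_normal_pdf m s.
apply: ge0_ae_eq_integral => //.
- apply: emeasurable_funM => //.
  exact: measurable_int (Radon_Nikodym_SigmaFinite.f_integrable (normal_prob_dominates m s)).
- by apply: emeasurable_funM => //; exact/measurable_EFinP.
- move=> x _; apply: mule_ge0 => //.
  exact: Radon_Nikodym_SigmaFinite.f_ge0 (normal_prob_dominates m s) _.
- by move=> x _; apply: mule_ge0; rewrite ?lee_fin ?normal_pdf_ge0.
have : ae_eq mu setT (Radon_Nikodym_SigmaFinite.f (normal_prob m s) mu)
    (fun x => (normal_pdf m s x)%:E).
  apply: integral_ae_eq => //.
  - exact: Radon_Nikodym_SigmaFinite.f_integrable (normal_prob_dominates m s).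
  - exact/measurable_EFinP.
  - move=> E _ mE.
    by rewrite -(Radon_Nikodym_SigmaFinite.f_integral (normal_prob_dominates m s)).
by apply: filterS => x /(_ Logic.I) -> _.
Qed.

(* With [u = (x - m)^2 / (2 s^2)]: [x^2 <= 2 m^2 + 4 s^2 u], and the factor [u] is
   absorbed by half of the exponent, [(u / 2) * exp (- u / 2) <= 1]. *)
Lemma sqr_normal_pdf_le (m s x : R) : 0 < s ->
  x ^+ 2 * normal_pdf m s x <=
  2 * m ^+ 2 * normal_pdf m s x +
  8 * s ^+ 2 * Num.sqrt 2 * normal_pdf m (Num.sqrt 2 * s) x.
Proof.
move=> s0; have s0' : s != 0 by rewrite gt_eqF.
have r2 : Num.sqrt 2 != 0 :> R by rewrite sqrtr_eq0 -ltNge.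
have r2s : Num.sqrt 2 * s != 0 by rewrite mulf_neq0.
rewrite !normal_pdfE//=.
(* Standard deviation [sqrt 2 * s] halves the exponent and divides the peak by [sqrt 2]; this is the
   factor [Num.sqrt 2] in the bound. *)
have -> : normal_peak (Num.sqrt 2 * s) = (Num.sqrt 2)^-1 * normal_peak s.
  rewrite /normal_peak exprMn sqr_sqrtr// -mulrA -mulrnAr sqrtrM//.
  by rewrite invfM.
set c := normal_peak s; have c0 : 0 <= c by exact: normal_peak_ge0.
rewrite /normal_fun exprMn sqr_sqrtr//.
set u := (x - m) ^+ 2 / (s ^+ 2 *+ 2).
have -> : - (x - m) ^+ 2 / (s ^+ 2 *+ 2) = - (u / 2) - u / 2.
  by rewrite /u; field.
have -> : - (x - m) ^+ 2 / (2 * s ^+ 2 *+ 2) = - (u / 2).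
  by rewrite /u; field.
have u0 : 0 <= u by rewrite mulr_ge0 ?sqr_ge0// invr_ge0 mulrn_wge0 ?sqr_ge0.
have xm : (x - m) ^+ 2 = 4 * s ^+ 2 * (u / 2).
  by rewrite /u; field.
have E2 : (u / 2) * expR (- (u / 2)) <= 1.
  rewrite expRN ler_pdivrMr ?expR_gt0// mul1r.
  by apply: le_trans (expR_ge1Dx _); rewrite lerDr.
rewrite expRD; set e := expR _; rewrite -/e in E2 *.
have e0 : 0 <= e by exact: expR_ge0.
(* This is [x^2 <= 2 m^2 + 2 (x - m)^2], a rearrangement of [(x - 2 m)^2 >= 0]. *)
have x2 : x ^+ 2 <= 2 * m ^+ 2 + 8 * s ^+ 2 * (u / 2).
  have -> : 8 * s ^+ 2 * (u / 2) = 2 * (4 * s ^+ 2 * (u / 2)) by ring.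
  by rewrite -xm; have := sqr_ge0 (x - 2 * m); nra.
have -> : 8 * s ^+ 2 * Num.sqrt 2 * ((Num.sqrt 2)^-1 * c * e) = 8 * s ^+ 2 * (c * e).
  by field.
apply: (@le_trans _ _ ((2 * m ^+ 2 + 8 * s ^+ 2 * (u / 2)) * (c * (e * e)))).
  by rewrite ler_wpM2r// !mulr_ge0.
have -> : (2 * m ^+ 2 + 8 * s ^+ 2 * (u / 2)) * (c * (e * e)) =
    2 * m ^+ 2 * (c * (e * e)) + 8 * s ^+ 2 * (c * e) * (u / 2 * e) by ring.
by rewrite lerD2l ler_piMr ?mulr_ge0 ?(ltW s0).
Qed.

Lemma normal_second_moment (m s : R) : 0 < s ->
  (\int[normal_prob m s]_x (x ^+ 2)%:E <=
   (2 * m ^+ 2 + 8 * s ^+ 2 * Num.sqrt 2)%:E)%E.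
Proof.
move=> s0.
rewrite integral_normal_prob; last 2 first.
- by apply/measurable_EFinP; exact: measurable_funX.
- by move=> x; rewrite lee_fin sqr_ge0.
have c1 : 0 <= 2 * m ^+ 2 by apply: mulr_ge0; rewrite ?sqr_ge0.
have c2 : 0 <= 8 * s ^+ 2 * Num.sqrt 2.
  by apply: mulr_ge0; rewrite ?sqrtr_ge0//; apply: mulr_ge0; rewrite ?sqr_ge0.
have msq : measurable_fun setT (fun x : R => (x ^+ 2)%:E).
  by apply/measurable_EFinP; exact: measurable_funX.
have mn a b : measurable_fun setT (fun x : R => (normal_pdf a b x)%:E).
  by apply/measurable_EFinP; exact: measurable_normal_pdf.
apply: (@le_trans _ _ (\int[mu]_x
  ((2 * m ^+ 2)%:E * (normal_pdf m s x)%:E +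
   (8 * s ^+ 2 * Num.sqrt 2)%:E * (normal_pdf m (Num.sqrt 2 * s) x)%:E)))%E.
  apply: ge0_le_integral => //.
  - by move=> x _; rewrite mule_ge0// lee_fin ?sqr_ge0 ?normal_pdf_ge0.
  - by apply: emeasurable_funM; [exact: msq|exact: mn].
  - by apply: emeasurable_funD; apply: emeasurable_funM => //; exact: mn.
  - by move=> x _; rewrite -!EFinM -EFinD lee_fin; exact: sqr_normal_pdf_le.
rewrite ge0_integralD//=; last 4 first.
- by move=> x _; rewrite mule_ge0// lee_fin ?normal_pdf_ge0.
- by apply: emeasurable_funM => //; exact: mn.
- by move=> x _; rewrite mule_ge0// lee_fin ?normal_pdf_ge0.
- by apply: emeasurable_funM => //; exact: mn.
have In a b (k : R) : 0 <= k ->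
    (\int[mu]_x (k%:E * (normal_pdf a b x)%:E) = k%:E)%E.
  move=> k0; rewrite ge0_integralZl_EFin//.
  - by rewrite integral_normal_pdf mule1.
  - by move=> x _; rewrite lee_fin normal_pdf_ge0.
  - exact: mn.
by rewrite !In.
Qed.

End normal_moments.

(** * Coordinates of a Gaussian product measure *)

Section gaussian_product.
Context (R : realType).

Lemma measurable_coord (i : nat) : measurable_fun setT (fun x : Rinf R => x i).
Proof.
move=> _ B mB; rewrite setTI; apply: sub_gen_smallest.
by exists i => //; exists B.
Qed.

(** The cylinder on the first [i.+1] coordinates with the whole line before coordinate [i] leaves a
    single factor different from 1. *)
Lemma gauss_prod_marginal (m : nat -> R) (s : R) (P : probability (Rinf R) R)
    (i : nat) (B : set R) : gauss_prod m s P -> measurable B ->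
  P [set x : Rinf R | B (x i)] = normal_prob (m i) s B.
Proof.
move=> hP mB.
have := hP i.+1 (fun j => if j == i then B else setT).
have -> : [set x : Rinf R | forall j, (j < i.+1)%N ->
    (if j == i then B else setT) (x j)] = [set x : Rinf R | B (x i)].
  apply/seteqP; split=> x /=.
    by move=> /(_ i (ltnSn i)); rewrite eqxx.
  by move=> Bx j _; case: eqP => [->|].
move=> ->; last by move=> j; case: ifP.
rewrite big_ord_recr/= eqxx big1 ?mul1e// => j _.
by rewrite ltn_eqF// probability_setT.
Qed.

Lemma gauss_prod_second_moment (m : nat -> R) (s : R)
    (P : probability (Rinf R) R) (i : nat) : 0 < s -> gauss_prod m s P ->
  (\int[P]_x ((x : nat -> R) i ^+ 2)%:E <=
   (2 * m i ^+ 2 + 8 * s ^+ 2 * Num.sqrt 2)%:E)%E.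
Proof.
move=> s0 hP; apply: le_trans (normal_second_moment (m i) s0).
pose X : {mfun Rinf R >-> measurableTypeR R} := HB.pack (fun x : Rinf R => x i)
  (@isMeasurableFun.Build _ _ (Rinf R) (measurableTypeR R) _ (measurable_coord i)).
have -> : (\int[P]_x ((x : nat -> R) i ^+ 2)%:E =
    \int[pushforward P X]_(y in [set: measurableTypeR R]) (y ^+ 2)%:E)%E.
  rewrite (ge0_integral_pushforward (measurable_funPT X))//.
  - by apply/measurable_EFinP; exact: measurable_funX.
  - by move=> y _; rewrite lee_fin sqr_ge0.
rewrite le_eqVlt; apply/orP; left; apply/eqP.
apply: (eq_measure_integral (normal_prob (m i) s)) => B mB _.
exact: gauss_prod_marginal hP mB.
Qed.

End gaussian_product.

(** * L2 limits of sequences that are rapidly Cauchy along a subsequence *)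

Section fast_L2_cauchy.
Context d (T : measurableType d) (R : realType).
Variables (mu : {measure set T -> \bar R}) (D : set T) (mD : measurable D).
Hypothesis muD : (mu D < +oo)%E.
Variables (f : nat -> T -> R) (s : nat -> R) (l : R) (phi : nat -> nat).
Hypothesis mf : forall n, measurable_fun D (f n).
Hypothesis f_dist : forall m n,
  (\int[mu]_(x in D) ((f m x - f n x) ^+ 2)%:E = `|s m - s n|%:E)%E.
Hypothesis s_cvg : s @ \oo --> l.
Hypothesis phi_cvg : phi @ \oo --> \oo.
Hypothesis fast : (\sum_(0 <= k <oo)
  (2 ^+ k * `|s (phi k.+1) - s (phi k)|)%:E < +oo)%E.

Let step k x := `|f (phi k.+1) x - f (phi k) x|.
Let total x := (\sum_(0 <= k <oo) (step k x)%:E)%E.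

Let step_ge0 k x : (0 <= (step k x)%:E)%E.
Proof. by rewrite lee_fin /step normr_ge0. Qed.

Let measurable_step k : measurable_fun D (fun x => (step k x)%:E).
Proof.
by apply/measurable_EFinP/measurableT_comp => //; exact: measurable_funB.
Qed.

(** Bounds an L1 norm by two terms, each summable over [k]: the first by [fast], the second as a
    geometric sequence, written in the shape that [epsilon_trick0] expects. *)
Let integral_step k : (\int[mu]_(x in D) (step k x)%:E <=
  (2 ^+ k * `|s (phi k.+1) - s (phi k)|)%:E +
  (2 * fine (mu D) / (2 ^ k.+1)%:R)%:E)%E.
Proof.
have muDE : mu D = (fine (mu D))%:E by rewrite fineK// ge0_fin_numE.
have msq : measurable_fun D (fun x => ((f (phi k.+1) x - f (phi k) x) ^+ 2)%:E).
  by apply/measurable_EFinP/measurable_funX; exact: measurable_funB.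
have p2 : 0 <= 2 ^+ k :> R by exact: exprn_ge0.
rewrite EFinM -f_dist -ge0_integralZl_EFin//; last first.
  by move=> x _; rewrite lee_fin sqr_ge0.
have -> : ((2 * fine (mu D) / (2 ^ k.+1)%:R)%:E =
    \int[mu]_(x in D) ((2 ^+ k)^-1 : R)%:E)%E.
  rewrite integral_cst// muDE -EFinM; congr EFin.
  by rewrite natrX exprS; field; rewrite expf_neq0.
rewrite -ge0_integralD//; last 2 first.
- by move=> x _; rewrite -EFinM lee_fin mulr_ge0// sqr_ge0.
- exact: emeasurable_funM.
apply: ge0_le_integral => //.
- by apply: emeasurable_funD => //; exact: emeasurable_funM.
(* AM-GM: [2 a <= 2^k a^2 + 2^(-k)] *)
move=> x _; rewrite -EFinM -EFinD lee_fin /step -real_normK ?num_real//.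
set a := `|_|; have p0 : 0 < 2 ^+ k :> R by rewrite exprn_gt0.
have a0 : 0 <= a by exact: normr_ge0.
have : 0 <= (2 ^+ k)^-1 * (2 ^+ k * a - 1) ^+ 2 by rewrite mulr_ge0 ?sqr_ge0 ?invr_ge0.
have -> : (2 ^+ k)^-1 * (2 ^+ k * a - 1) ^+ 2 = 2 ^+ k * a ^+ 2 + (2 ^+ k)^-1 - 2 * a.
  by field; rewrite gt_eqF.
by rewrite subr_ge0; apply: le_trans; rewrite ler_peMl// ler1n.
Qed.

Let measurable_total : measurable_fun D total.
Proof.
by apply: ge0_emeasurable_sum => k *; [exact: step_ge0|exact: measurable_step].
Qed.

Let total_ge0 x : (0 <= total x)%E.
Proof. by apply: nneseries_ge0 => k _ _; exact: step_ge0. Qed.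

Let total_lty : {ae mu, forall x, D x -> (total x < +oo)%E}.
Proof.
have : mu.-integrable D total.
  apply/integrableP; split => //.
  under eq_integral do rewrite gee0_abs//.
  rewrite integral_nneseries//.
  apply: (@le_lt_trans _ _ (\sum_(0 <= k <oo)
    ((2 ^+ k * `|s (phi k.+1) - s (phi k)|)%:E +
     (2 * fine (mu D) / (2 ^ k.+1)%:R)%:E))%E).
    apply: lee_nneseries => k *; last exact: integral_step.
    by apply: integral_ge0 => x _; exact: step_ge0.
  have muD0 : 0 <= 2 * fine (mu D) by rewrite mulr_ge0// fine_ge0.
  rewrite nneseriesD//.
  rewrite lte_add_pinfty//.
  by apply: le_lt_trans (epsilon_trick0 xpredT muD0) _; rewrite ltry.
move=> /(integrable_ae mD); apply: filterS => x H /H.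
by rewrite ge0_fin_numE.
Qed.

Let cvg_subseq x : (total x < +oo)%E -> cvgn (fun k => f (phi k) x).
Proof.
move=> tx; have st : cvgn (series (fun k => step k x)).
  by apply: nnseries_is_cvg => // k; exact: normr_ge0.
have : cvgn (series (telescope (fun k => f (phi k) x))) by exact: normed_cvg.
move=> /cvg_ex[m hm].
have -> : (fun k => f (phi k) x) =
    (fun k => f (phi 0%N) x + series (telescope (fun k => f (phi k) x)) k).
  by apply/funext => k; rewrite telescopeK/= addrC addrNK.
by apply/cvg_ex; exists (f (phi 0%N) x + m); apply: cvgD => //; exact: cvg_cst.
Qed.

(** The limit [g] is taken almost everywhere along [phi]. For fixed [n], Fatou's lemma applied to
    the squared distances from [f n] to [f (phi k)] then controls the whole sequence, not only the
    subsequence. *)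
Lemma fast_L2_cauchy_limit : exists g : T -> R, measurable_fun D g /\
  forall n, (\int[mu]_(x in D) ((f n x - g x) ^+ 2)%:E <= `|s n - l|%:E)%E.
Proof.
pose E := D `&` [set x | (total x < +oo)%E].
have mE : measurable E by exact: emeasurable_fun_infty_o.
(* Setting the functions to zero where [total] is infinite makes them converge everywhere on [D], so
   that the limit is measurable. *)
pose h k x := f (phi k) x * \1_E x.
pose g x := limn (h ^~ x).
have hg x : D x -> h ^~ x @ \oo --> g x.
  move=> Dx; have [tx|tx] := pselect (total x < +oo)%E.
    have -> : h ^~ x = fun k => f (phi k) x.
      by apply/funext => k; rewrite /h indicE mem_set ?mulr1.
    rewrite /g; have -> : h ^~ x = fun k => f (phi k) x.
      by apply/funext => k; rewrite /h indicE mem_set ?mulr1.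
    exact: cvg_subseq.
  have h0 : h ^~ x = cst 0.
    by apply/funext => k; rewrite /h indicE memNset ?mulr0// => -[].
  by rewrite /g h0 lim_cst//; exact: cvg_cst.
have mg : measurable_fun D g.
  apply: (measurable_fun_cvg (h := h)) => // k.
  by apply: measurable_funM => //; exact: measurable_indic.
have mfg n k : measurable_fun D (fun x => ((f n x - f k x) ^+ 2)%:E).
  by apply/measurable_EFinP/measurable_funX; exact: measurable_funB.
exists g; split => // n.
have dist_cvg : (fun k => `|s n - s (phi k)|%:E) @ \oo --> (`|s n - l|%:E)%E.
  apply: cvg_EFin; first by apply: nearW.
  apply: cvg_norm; apply: cvgB; first exact: cvg_cst.
  exact: cvg_comp phi_cvg s_cvg.
(* The right-hand side becomes a lower limit of integrals, ready for Fatou. *)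
rewrite -(cvg_limn_einf_sup dist_cvg).1.
under [X in (_ <= limn_einf X)%E]eq_fun do rewrite -f_dist.
apply: (le_trans _ (fatou mu mD (fun k => mfg n (phi k)) _)); last first.
  by move=> k x _; rewrite lee_fin sqr_ge0.
apply: ae_ge0_le_integral => //.
- by move=> x _; rewrite lee_fin sqr_ge0.
- by apply/measurable_EFinP/measurable_funX; exact: measurable_funB.
- move=> x _; rewrite limn_einf_lim; apply: lime_ge; first exact: is_cvg_einfs.
  by apply: nearW => k; apply: le_ereal_inf_tmp => _ /= [j _ <-]; rewrite lee_fin sqr_ge0.
- rewrite /limn_einf; apply: measurableT_comp => //.
  by apply: measurable_fun_limn_esup => k; exact: measurableT_comp (mfg n _).
apply: filterS total_lty => x tx Dx; rewrite le_eqVlt; apply/orP; left; apply/eqP.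
apply/esym; apply: (cvg_limn_einf_sup _).1.
apply: cvg_EFin; first by apply: nearW.
apply: (cvg_comp _ (fun y => y ^+ 2)); last exact: exprn_continuous.
apply: cvgB; first exact: cvg_cst.
have -> : (fun k => f (phi k) x) = h ^~ x.
  by apply/funext => k; rewrite /h indicE mem_set ?mulr1//; split => //; exact: tx.
exact: hg.
Qed.

End fast_L2_cauchy.

(** * Orthonormality of the sine system on the unit interval *)

Section sine_basis.
Context (R : realType).

(** A primitive of [cos (b * t)] vanishing at 0; the case [b = 0] occurs on the diagonal [i = j]. *)
Let cos_prim (b : R) : R -> R :=
  if b == 0 then id else fun t => sin (b * t) / b.

Let is_derive_cos_prim (b t : R) : is_derive t 1 (cos_prim b) (cos (b * t)).
Proof.
rewrite /cos_prim; case: ifPn => [/eqP ->|b0].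
  by rewrite mul0r cos0; exact: is_derive_id.
have -> : (fun t => sin (b * t) / b) = b^-1 *: (sin \o ( *%R b)) :> (R -> R).
  by apply/funext => u; rewrite [RHS]mulrC.
apply: is_derive_eq.
by rewrite /GRing.scale/= mulr1 mulrCA mulVf// mulr1.
Qed.

Let sin_mulnpi (k : nat) : sin (k%:R * pi) = 0 :> R.
Proof.
elim: k => [|k IH]; first by rewrite mul0r sin0.
by rewrite -natr1 mulrDl mul1r sinDpi IH oppr0.
Qed.

Let freq (i : nat) : R := (i%:R + 2^-1) * pi.

(** Primitive of [efun i * efun j], from [2 sin a sin b = cos (a - b) - cos (a + b)]. *)
Let prod_prim (i j : nat) (t : R) : R :=
  cos_prim (freq i - freq j) t - cos_prim (freq i + freq j) t.

Let is_derive_prod_prim (i j : nat) (t : R) :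
  is_derive t 1 (prod_prim i j) (efun i t * efun j t).
Proof.
have -> : efun i t * efun j t =
    cos ((freq i - freq j) * t) - cos ((freq i + freq j) * t).
  rewrite mulrBl mulrDl cosB cosD /efun -/(freq i) -/(freq j).
  rewrite mulrACA -expr2 sqr_sqrtr//; ring.
exact: is_deriveB.
Qed.

(** The frequencies have sum [(i + j + 1) pi] and difference [(i - j) pi], so every sine at 1
    vanishes; only the linear primitive of the diagonal case contributes. *)
Let prod_prim_itv (i j : nat) : prod_prim i j 1 - prod_prim i j 0 = (i == j)%:R.
Proof.
have pi0 : pi != 0 :> R by rewrite gt_eqF// pi_gt0.
have C0 b : cos_prim b 0 = 0.
  by rewrite /cos_prim; case: ifPn => // _; rewrite mulr0 sin0 mul0r.
rewrite /prod_prim !C0 !subr0.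
have -> : freq i + freq j = (i + j).+1%:R * pi.
  by rewrite /freq -[(i + j).+1]addn1 !natrD; field.
rewrite [in X in _ - X]/cos_prim ifF; last first.
  by rewrite mulf_eq0 (negbTE pi0) orbF pnatr_eq0.
rewrite mulr1 sin_mulnpi mul0r subr0 /freq -mulrBl.
have -> : i%:R + 2^-1 - (j%:R + 2^-1) = i%:R - j%:R :> R by ring.
rewrite /cos_prim mulf_eq0 (negbTE pi0) orbF subr_eq0 eqr_nat.
case: ifPn => // ij; rewrite mulr1.
have [ji|/ltnW ji] := leqP j i.
  by rewrite -natrB// sin_mulnpi mul0r.
by rewrite -opprB mulNr sinN -natrB// sin_mulnpi oppr0 mul0r.
Qed.

Lemma continuous_efun (i : nat) : continuous (@efun R i).
Proof.
move=> t; apply: cvgM; first exact: cvg_cst.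
apply: (cvg_comp _ sin); last exact: continuous_sin.
by apply: cvgM; [exact: cvg_cst|exact: cvg_id].
Qed.

(** The square expands into a double sum with the explicit primitive [F], whose off-diagonal
    increments are zero. *)
Lemma integral_sqr_efun_sum (n : nat) (b : nat -> R) :
  (\int[lebesgue_measure]_(t in (`[0%R, 1%R] : set R))
     ((\sum_(i < n) b i * efun i t) ^+ 2)%:E = (\sum_(i < n) b i ^+ 2)%:E)%E.
Proof.
pose F : R -> R := \sum_(i < n) \sum_(j < n) (b i * b j) *: prod_prim i j.
pose f (t : R) := (\sum_(i < n) b i * efun i t) ^+ 2.
have fE t : f t = \sum_(i < n) \sum_(j < n) (b i * b j) *: (efun i t * efun j t).
  rewrite /f expr2 big_distrlr/=; apply: eq_bigr => i _; apply: eq_bigr => j _.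
  by rewrite /GRing.scale/= mulrACA.
have dF (t : R) : is_derive t (1 : R) F (f t).
  rewrite fE; apply: is_derive_sum => i; apply: is_derive_sum => j.
  exact: is_deriveZ.
have cF : continuous F.
  by move=> t; apply/differentiable_continuous/derivable1_diffP/ex_derive.
have cf : continuous f.
  move=> t; apply: (cvg_comp _ (fun y => y ^+ 2)); last exact: exprn_continuous.
  apply: (cvg_big add_continuous) => i _.
  by apply: cvgM; [exact: cvg_cst|exact: continuous_efun].
rewrite (@continuous_FTC2 _ f F)//.
- have FE t : F t = \sum_(i < n) \sum_(j < n) b i * b j * prod_prim i j t.
    rewrite /F fct_sumE; apply: eq_bigr => i _; rewrite fct_sumE.
    by apply: eq_bigr.
  rewrite !FE -EFinB; congr EFin.
  rewrite -sumrB; apply: eq_bigr => i _.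
  rewrite -sumrB (bigD1 i)//= -mulrBr prod_prim_itv eqxx mulr1 -expr2.
  rewrite big1 ?addr0// => j ji; rewrite -mulrBr prod_prim_itv.
  by rewrite eq_sym val_eqE (negbTE ji) mulr0.
- exact: continuous_subspaceT.
- split; first by move=> t _; exact: ex_derive.
  + by apply: cvg_at_right_filter; exact: cF.
  + by apply: cvg_at_left_filter; exact: cF.
- by move=> t _; rewrite derive1E; exact: derive_val.
Qed.

End sine_basis.

(** * Energies of partial sums and the dyadic event *)

Section dyadic_set.
Context (R : realType).

(** The squared L2 norm of [partial_sum x n] on the unit interval. *)
Definition energy (x : nat -> R) : nat -> R :=
  series (fun i => lam R i * x i ^+ 2).

Lemma lam_ge0 (i : nat) : 0 <= lam R i.
Proof. by rewrite /lam invr_ge0 sqr_ge0. Qed.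

Lemma nondecreasing_energy (x : nat -> R) : nondecreasing_seq (energy x).
Proof.
move=> m n mn; rewrite -subr_ge0 /energy sub_series_geq//.
by apply: sumr_ge0 => i _; rewrite mulr_ge0 ?lam_ge0 ?sqr_ge0.
Qed.

Lemma partial_sum_dist (x : nat -> R) (m n : nat) :
  (\int[lebesgue_measure]_(t in (`[0%R, 1%R] : set R))
     ((partial_sum x m t - partial_sum x n t) ^+ 2)%:E =
   `|energy x m - energy x n|%:E)%E.
Proof.
wlog mn : m n / (n <= m)%N => [H|].
  have [|/ltnW mn] := leqP n m; first exact: H.
  rewrite distrC -(H _ _ mn); apply: eq_integral => t _.
  by rewrite -sqrrN opprB.
rewrite ger0_norm ?subr_ge0 ?nondecreasing_energy// /energy sub_series_geq//.
(* Zero coefficients below [n] turn the difference of partial sums into one sum over [i < m]. *)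
pose b i := if (n <= i)%N then x i * Num.sqrt (lam R i) else 0.
have bE (F : nat -> R) :
    \sum_(i < m) (if (n <= i)%N then F i else 0) = \sum_(n <= i < m) F i.
  by rewrite -big_mkcond big_geq_mkord.
transitivity (\int[lebesgue_measure]_(t in (`[0%R, 1%R] : set R))
    ((\sum_(i < m) b i * efun i t) ^+ 2)%:E)%E.
  apply: eq_integral => t _; congr ((_ ^+ 2)%:E).
  pose u i := x i * Num.sqrt (lam R i) * efun i t.
  transitivity (series u m - series u n).
    by rewrite /series/= !big_mkord.
  rewrite sub_series_geq// -bE; apply: eq_bigr => i _.
  by rewrite /b /u; case: ifP => // _; rewrite mul0r.
rewrite integral_sqr_efun_sum; congr EFin.
rewrite -bE; apply: eq_bigr => i _; rewrite /b.
case: ifP => _; last by rewrite expr0n.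
by rewrite exprMn sqr_sqrtr ?lam_ge0// mulrC.
Qed.

(* Only the inclusion in [SD] is proved: measurability of [SD] is not needed, since
   conditioning on a measurable subset of [SD] gives mass 1 to [SD]. *)
Definition dyadic_set : set (Rinf R) := [set x : Rinf R |
  (\sum_(0 <= k <oo)
    (2 ^+ k * (energy x (4 ^ k.+1)%N - energy x (4 ^ k)%N))%:E < +oo)%E].

Let block_ge0 (x : nat -> R) (k : nat) :
  0 <= 2 ^+ k * (energy x (4 ^ k.+1)%N - energy x (4 ^ k)%N).
Proof.
by rewrite mulr_ge0 ?exprn_ge0// subr_ge0 nondecreasing_energy// leq_exp2l.
Qed.

(** The weights [2 ^+ k] are at least 1, so the unweighted block increments are summable; this
    bounds the monotone energy along [4 ^ k], hence everywhere since [n <= 4 ^ n]. *)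
Lemma cvg_energy (x : nat -> R) : dyadic_set x -> cvgn (energy x).
Proof.
move=> xA; apply: nondecreasing_is_cvgn; first exact: nondecreasing_energy.
have : cvgn (series (telescope (fun k => energy x (4 ^ k)%N))).
  apply: (@series_le_cvg _ _ _ _ _ _ (nnseries_is_cvg (block_ge0 x) xA)) => k.
  - by rewrite /telescope/= subr_ge0 nondecreasing_energy// leq_exp2l.
  - exact: block_ge0.
  - rewrite /telescope/= ler_peMl//; last by rewrite exprn_ege1// ler1n.
    by rewrite subr_ge0 nondecreasing_energy// leq_exp2l.
rewrite telescopeK => /cvg_seq_bounded/bounded_fun_has_ubound[M HM].
(* [M] bounds the telescoped sum, which starts from [energy x (4 ^ 0)]; hence the added
   [energy x 1]. *)
exists (M + energy x 1) => _ [n _ <-].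
apply: (@le_trans _ _ (energy x (4 ^ n)%N)).
  by apply: nondecreasing_energy; exact/ltnW/ltn_expl.
by rewrite -lerBlDr; apply: HM; exists n.
Qed.

Lemma dyadic_set_SD : dyadic_set `<=` (@SD R).
Proof.
move=> x xA.
have /cvg_ex[l xl] := cvg_energy xA.
have phi_cvg : (fun k => 4 ^ k)%N @ \oo --> \oo.
  move=> U [N _ NU]; exists N => // k /= Nk; apply: NU => /=.
  exact: leq_trans Nk (ltnW (ltn_expl k _)).
have fast : (\sum_(0 <= k <oo) (2 ^+ k *
    `|energy x (4 ^ k.+1)%N - energy x (4 ^ k)%N|)%:E < +oo)%E.
  under eq_eseriesr => k _.
    rewrite ger0_norm; last by rewrite subr_ge0 nondecreasing_energy// leq_exp2l.
    over.
  exact: xA.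
have mS n : measurable_fun (`[0%R, 1%R] : set R) (partial_sum x n).
  apply: measurable_sum => i; apply: measurable_funM => //.
  by apply: measurable_funTS; apply: continuous_measurable_fun; exact: continuous_efun.
have [||g [mg Hg]] := fast_L2_cauchy_limit (mu := lebesgue_measure) _ _ mS
  (partial_sum_dist x) xl phi_cvg fast.
- exact: measurable_itv.
- have m1 := lebesgue_measure_itv (`[0, 1] : interval R).
  have m1y : (lebesgue_measure (`[0%R, 1%R] : set R) < +oo)%E.
    by rewrite m1/= lte01 -EFinB ltry.
  exact: m1y.
exists g; split => //.
(* Square integrability of [g] is the case [n = 0] of [Hg], since the empty partial sum is zero. *)
- apply: le_lt_trans (ltry `|energy x 0%N - l|).
  apply: le_trans (Hg 0%N); rewrite le_eqVlt; apply/orP; left; apply/eqP.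
  apply: eq_integral => t _.
  by rewrite /partial_sum big_ord0 sub0r sqrrN.
- apply: (@squeeze_cvge _ _ _ _ (cst 0%E) _ (fun n => `|energy x n - l|%:E)).
  + apply: nearW => n; rewrite Hg andbT.
    by apply: integral_ge0 => t _; rewrite lee_fin sqr_ge0.
  + exact: cvg_cst.
  + apply: cvg_EFin; first exact: nearW.
    rewrite -[X in _ --> X](normr0 R) -(subrr l).
    by apply: cvg_norm; apply: cvgB => //; exact: cvg_cst.
Qed.

(** * Measurability and full Gaussian mass of the dyadic event *)

Lemma measurable_energy (n : nat) :
  measurable_fun setT (fun x : Rinf R => energy x n).
Proof.
apply: measurable_sum => i; apply: measurable_funM => //.
by apply: measurable_funX; exact: measurable_coord.
Qed.

Let measurable_block (k : nat) : measurable_fun setT (fun x : Rinf R =>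
  (2 ^+ k * (energy x (4 ^ k.+1)%N - energy x (4 ^ k)%N))%:E).
Proof.
apply/measurable_EFinP; apply: measurable_funM => //.
by apply: measurable_funB; exact: measurable_energy.
Qed.

Let measurable_blocks : measurable_fun setT (fun x : Rinf R =>
  (\sum_(0 <= k <oo)
    (2 ^+ k * (energy x (4 ^ k.+1)%N - energy x (4 ^ k)%N))%:E)%E).
Proof.
apply: ge0_emeasurable_sum => k *; last exact: measurable_block.
by rewrite lee_fin; exact: block_ge0.
Qed.

Lemma measurable_dyadic_set : measurable dyadic_set.
Proof.
have := emeasurable_fun_infty_o measurableT measurable_blocks +oo%E.
by rewrite setTI.
Qed.

Lemma lam_le (k i : nat) : (4 ^ k <= i)%N -> lam R i <= (16 ^+ k)^-1.
Proof.
move=> ki.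
have p0 : 0 < (4 ^ k)%:R :> R by rewrite ltr0n expn_gt0.
have pile : (4 ^ k)%:R <= pi * (i%:R + 2^-1) :> R.
  apply: (@le_trans _ _ i%:R); first by rewrite ler_nat.
  have := pi_ge2 R; have : 0 <= i%:R :> R by []. nra.
have -> : 16 ^+ k = (4 ^ k)%:R ^+ 2 :> R by rewrite -!natrX -expnM mulnC expnM.
have q0 := lt_le_trans p0 pile.
by rewrite /lam lef_pV2 ?posrE ?exprn_gt0// ler_pXn2r ?nnegrE ?(ltW p0) ?(ltW q0).
Qed.

Lemma gauss_prod_dyadic_set (m : nat -> R) (s B : R)
    (P : probability (Rinf R) R) : 0 < s -> (forall i, m i ^+ 2 <= B) ->
  gauss_prod m s P -> P dyadic_set = 1%E.
Proof.
move=> s0 mB hP.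
pose M := 2 * B + 8 * s ^+ 2 * Num.sqrt 2.
have B0 : 0 <= B by rewrite (le_trans _ (mB 0%N))// sqr_ge0.
have M0 : 0 <= M by rewrite addr_ge0 ?mulr_ge0 ?sqr_ge0 ?sqrtr_ge0 ?(ltW s0).
have msq i : measurable_fun setT (fun x : Rinf R => ((x : nat -> R) i ^+ 2)%:E).
  by apply/measurable_EFinP/measurable_funX; exact: measurable_coord.
have m2 i : (\int[P]_x ((x : nat -> R) i ^+ 2)%:E <= M%:E)%E.
  apply: le_trans (gauss_prod_second_moment i s0 hP) _.
  by rewrite lee_fin lerD2r ler_pM2l.
(* Block [k] has [3 * 4^k] terms, each of expectation at most [M / 16^k]; with the weight [2^k] this
   gives [3 M / 2^k = 6 M / 2^(k+1)], and these bounds sum to [6 M]. *)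
have blockP k : (\int[P]_x (2 ^+ k *
    (energy x (4 ^ k.+1)%N - energy x (4 ^ k)%N))%:E <=
    ((6 * M) / (2 ^ k.+1)%:R)%:E)%E.
  have le4 : (4 ^ k <= 4 ^ k.+1)%N by rewrite leq_exp2l.
  have p2 : 0 <= 2 ^+ k :> R by exact: exprn_ge0.
  under eq_integral => x _.
    rewrite /energy sub_series_geq// EFinM -sumEFin.
    under eq_bigr do rewrite EFinM.
    over.
  have mterm i : measurable_fun setT
      (fun x : Rinf R => (lam R i)%:E * ((x : nat -> R) i ^+ 2)%:E)%E.
    by apply: emeasurable_funM => //; exact: msq.
  have term0 i (x : Rinf R) : (0 <= (lam R i)%:E * ((x : nat -> R) i ^+ 2)%:E)%E.
    by rewrite mule_ge0// lee_fin ?lam_ge0 ?sqr_ge0.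
  rewrite ge0_integralZl_EFin//; last 2 first.
  - by move=> x _; apply: sume_ge0.
  - exact: emeasurable_sum.
  rewrite ge0_integral_sum//.
  apply: (@le_trans _ _ ((2 ^+ k)%:E *
      \sum_(4 ^ k <= i < 4 ^ k.+1) ((16 ^+ k)^-1 * M)%:E)%E).
    rewrite lee_wpmul2l ?lee_fin// big_nat_cond [leRHS]big_nat_cond.
    apply: lee_sum => i; rewrite andbT => /andP[ki _].
    rewrite ge0_integralZl_EFin ?lam_ge0//; last first.
      by move=> x _; rewrite lee_fin sqr_ge0.
    rewrite EFinM; apply: lee_pmul; rewrite ?lee_fin ?lam_ge0 ?lam_le//.
    by apply: integral_ge0 => x _; rewrite lee_fin sqr_ge0.
  rewrite sumEFin sumr_const_nat -EFinM lee_fin -[_ *+ (_ - _)]mulr_natr natrB// !natrX.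
  rewrite !exprS; have -> : 16 = 4 * 4 :> R by ring.
  have -> : 4 = 2 * 2 :> R by ring.
  rewrite !exprMn le_eqVlt; apply/orP; left; apply/eqP.
  by field; rewrite expf_neq0.
have fin : (\int[P]_x \sum_(0 <= k <oo) (2 ^+ k *
    (energy x (4 ^ k.+1)%N - energy x (4 ^ k)%N))%:E < +oo)%E.
  rewrite integral_nneseries//; last by move=> k x _; rewrite lee_fin block_ge0.
  have M60 : 0 <= 6 * M by rewrite mulr_ge0.
  apply: le_lt_trans (ltry (6 * M)).
  apply: le_trans (epsilon_trick0 xpredT M60).
  apply: lee_nneseries => k *; last exact: blockP.
  by apply: integral_ge0 => x _; rewrite lee_fin block_ge0.
have : P.-integrable setT (fun x : Rinf R => \sum_(0 <= k <oo) (2 ^+ k *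
    (energy x (4 ^ k.+1)%N - energy x (4 ^ k)%N))%:E)%E.
  apply/integrableP; split => //.
  under eq_integral => x _.
    rewrite gee0_abs; last by apply: nneseries_ge0 => k _ _; rewrite lee_fin block_ge0.
    over.
  exact: fin.
move=> /(integrable_ae measurableT) H.
have mA := measurable_dyadic_set.
suff PA : P (~` dyadic_set) = 0%E.
  by rewrite -(setCK dyadic_set) probability_setC ?PA ?sube0//; exact: measurableC.
have : P.-negligible (~` dyadic_set).
  move: H; apply: negligibleS => x xA H; apply: xA.
  rewrite /dyadic_set/= -ge0_fin_numE ?H//.
  by apply: nneseries_ge0 => k _ _; rewrite lee_fin block_ge0.
by move=> /(measure_negligible (measurableC mA)).
Qed.

Lemma l2_sqr_bounded (theta : nat -> R) : l2 theta ->
  exists B, forall i, theta i ^+ 2 <= B.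
Proof.
move=> h; exists (limn (series (fun i => theta i ^+ 2))) => i.
have sq_nd : nondecreasing_seq (series (fun i => theta i ^+ 2)).
  by apply/nondecreasing_seqP => n; rewrite /series/= big_nat_recr//= lerDl sqr_ge0.
apply: le_trans (nondecreasing_cvgn_le sq_nd h i.+1).
by rewrite /series/= big_nat_recr//= lerDr sumr_ge0// => j _; rewrite sqr_ge0.
Qed.

Lemma l2_dyadic_set (theta : nat -> R) (s : R) (P : probability (Rinf R) R) :
  0 < s -> l2 theta -> gauss_prod theta s P -> P dyadic_set = 1%E.
Proof.
by move=> s0 /l2_sqr_bounded[B HB]; exact: gauss_prod_dyadic_set s0 HB.
Qed.

(** Supplies the fallback law for conditioning when the dyadic event has mass zero: all energies of
    the zero sequence vanish. *)
Lemma in_AD_dirac0 : in_AD (dirac (cst 0 : Rinf R) : probability (Rinf R) R).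
Proof.
rewrite /in_AD /= diracE mem_set//; apply: dyadic_set_SD; rewrite /dyadic_set/=.
have e0 n : energy (cst 0) n = 0.
  by rewrite /energy /series/= big1// => i _; rewrite expr0n mulr0.
by rewrite eseries0// => k _ _; rewrite !e0 subrr mulr0.
Qed.

End dyadic_set.

Unset Implicit Arguments.
Set Strict Implicit.

Theorem theorem2p2 (R : realType) (eps teps : R) (heps : 0 < eps) (hteps : 0 < teps)
  (P Q : (nat -> R) -> probability (Rinf R) R)
  (hP : forall theta, l2 theta -> gauss_prod theta eps (P theta))
  (hQ : forall theta, l2 theta -> gauss_prod theta teps (Q theta)) :
  (forall theta, l2 theta -> forall Q' : probability (Rinf R) R,
     exists Qt : probability (Rinf R) R,
       in_AD Qt /\ (KL (Q theta) Qt <= KL (Q theta) Q')%E) /\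
  (forall Theta : set (nat -> R), Theta `<=` @l2 R ->
     ereal_inf [set ereal_sup [set risk (P theta) (Q theta) Qhat | theta in Theta]
               | Qhat in [set: Rinf R -> probability (Rinf R) R]] =
     ereal_inf [set ereal_sup [set risk (P theta) (Q theta) Qhat | theta in Theta]
               | Qhat in [set Qhat : Rinf R -> probability (Rinf R) R |
                           forall x, in_AD (Qhat x)]]).
Proof.
split; last first.
  move=> Theta Tl2.
  apply: (minimax_eq_conditioned (@measurable_dyadic_set R) (@dyadic_set_SD R)
    (in_AD_dirac0 R) P) => theta /Tl2 th.
  exact: l2_dyadic_set hteps th (hQ theta th).
move=> theta th Q'.
exists (condition Q' (dirac (cst 0 : Rinf R)) (@measurable_dyadic_set R)); split.
  by apply: in_AD_condition; [exact: dyadic_set_SD|exact: in_AD_dirac0].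
by apply: KL_condition_le; exact: l2_dyadic_set hteps th (hQ theta th).
Qed.
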